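(* For any integer $n\ge 1$, any $x\in[0,1]$, and any real numbers $c'\ge c\ge -\frac{1}{n-1}\min\{x,1-x\}$ (for $n=1$ the lower bound on $c$ is understood as no restriction), the Pólya random variables satisfy the convex ordering $$X_n^{x,1-x,c}\le_{\mathrm{cx}} X_n^{x,1-x,c'}.$$
   Context: For $y,h\in\mathbb{R}$ and an integer $m\ge 0$, the generalized rising factorial with increment $h$ is $y^{(m,h)}=y(y+h)(y+2h)\cdots(y+(m-1)h)$, with $y^{(0,h)}=1$ (empty product). For real $a,b\ge 0$ and $c$ and an integer $n\ge1$ satisfying the compatibility condition $a+(n-1)c\ge 0$ and $b+(n-1)c\ge 0$, a Pólya random variable $X_n^{a,b,c}$ with parameters $a,b,c,n$ is a random variable with values in $\{0,1,\ldots,n\}$ and distribution $$P\left(X_n^{a,b,c}=k\right)=p_{n,k}^{a,b,c}=\binom{n}{k}\frac{a^{(k,c)}\,b^{(n-k,c)}}{(a+b)^{(n,c)}},\qquad k\in\{0,1,\ldots,n\}.$$ For $a=x$, $b=1-x$ with $x\in[0,1]$ and $n\ge 2$, the compatibility condition reads $c\ge -\frac{1}{n-1}\min\{x,1-x\}$; for $n=1$ it is satisfied by every real $c$. A random variable $X$ is smaller in the convex order than a random variable $Y$, written $X\le_{\mathrm{cx}}Y$, if $E(\phi(X))\le E(\phi(Y))$ for every convex function $\phi:\mathbb{R}\to\mathbb{R}$ for which these expectations exist. *)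

(* Defs.v *)
From mathcomp Require Export all_boot all_order all_algebra.
From mathcomp Require Export all_classical all_reals all_analysis.

Set Implicit Arguments.
Unset Strict Implicit.
Unset Printing Implicit Defensive.

Import Order.TTheory GRing.Theory Num.Theory.
Import numFieldNormedType.Exports.

Local Open Scope classical_set_scope.
Local Open Scope ring_scope.

Definition rising_factorial (R : realType) (y h : R) (m : nat) : R :=
  \prod_(i < m) (y + i%:R * h).

Definition polya_pmf (R : realType) (a b c : R) (n k : nat) : R :=
  'C(n, k)%:R * (rising_factorial a c k * rising_factorial b c (n - k)
                 / rising_factorial (a + b) c n).

(* The range of parameters for which [polya_pmf] is a probability mass function
   (a, b >= 0, 1 <= n, a + (n-1)c >= 0, b + (n-1)c >= 0) is not part of this
   predicate; it has to be assumed where the predicate is used. *)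
Definition polya_rv (R : realType) (d : measure_display) (T : measurableType d)
    (P : probability T R) (X : {RV P >-> R}) (a b c : R) (n : nat) : Prop :=
  (forall w : T, exists2 k : nat, (k <= n)%N & X w = k%:R) /\
  (forall k : nat, (k <= n)%N ->
     P (X @^-1` [set k%:R]) = (polya_pmf a b c n k)%:E).

(* The expectation exists in [-oo, +oo]: the positive and the negative part do
   not both have infinite integral.  This is weaker than integrability. *)
Definition expectation_exists (R : realType) (d : measure_display)
    (T : measurableType d) (P : probability T R) (f : T -> R) : Prop :=
  measurable_fun setT f /\
  ((\int[P]_w ((fun w' => (f w')%:E)^\+ w) < +oo)%E \/
   (\int[P]_w ((fun w' => (f w')%:E)^\- w) < +oo)%E).

Definition convex_order (R : realType)
    (d1 : measure_display) (T1 : measurableType d1) (P : probability T1 R)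
    (X : {RV P >-> R})
    (d2 : measure_display) (T2 : measurableType d2) (Q : probability T2 R)
    (Y : {RV Q >-> R}) : Prop :=
  forall phi : R -> R,
    @convex_function R R^o setT phi ->
    expectation_exists P (phi \o X) ->
    expectation_exists Q (phi \o Y) ->
    ('E_P[phi \o X] <= 'E_Q[phi \o Y])%E.

(* Main.v *)
(** Write p_k and q_k for the mass functions with parameters a = x, b = 1 - x
    and increments c <= c'.  The sign
    of q_(k+1) p_k - q_k p_(k+1) is that of k (a + b) - (n - 1) a, so the ratio
    q_k / p_k first decreases and then increases and {k | q_k < p_k} is an
    interval of integers.  By the Chu-Vandermonde identity both laws have the
    same mass and the same mean, so in the sum of (q_k - p_k) phi(k) one may
    subtract from phi a chord through the ends of that interval, after which
    every term is nonnegative. *)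
Require Import Defs.
From mathcomp Require Import all_boot all_order all_algebra.
From mathcomp Require Import all_classical all_reals all_analysis.
From mathcomp Require Import measurable_realfun ring lra zify.

Import Order.TTheory GRing.Theory Num.Theory.
Local Open Scope ring_scope.

Set Implicit Arguments.
Unset Strict Implicit.
Unset Printing Implicit Defensive.

(** * Rising factorials and the Chu-Vandermonde identity *)

Lemma rising_factorial0 (R : realType) (y h : R) : rising_factorial y h 0 = 1.
Proof. by rewrite /rising_factorial big_ord0. Qed.

Lemma rising_factorialS (R : realType) (y h : R) m :
  rising_factorial y h m.+1 = rising_factorial y h m * (y + m%:R * h).
Proof. by rewrite /rising_factorial big_ord_recr. Qed.

Lemma rising_factorialSl (R : realType) (y h : R) m :
  rising_factorial y h m.+1 = y * rising_factorial (y + h) h m.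
Proof.
rewrite /rising_factorial big_ord_recl mul0r addr0; congr (_ * _).
by apply: eq_bigr => i _; rewrite lift0 -natr1; ring.
Qed.

(** Induction on [n]: Pascal's rule splits the sum into [F], with an extra factor a + k h, and [G],
    with an extra factor b + (n - k) h; these two factors add up to a + b + n h for every k. *)
Lemma chu_vandermonde (R : realType) (a b h : R) n :
  \sum_(k < n.+1) 'C(n, k)%:R *
     (rising_factorial a h k * rising_factorial b h (n - k))
  = rising_factorial (a + b) h n.
Proof.
elim: n => [|n IH].
  by rewrite big_ord1 !rising_factorial0 bin0 !mulr1.
rewrite rising_factorialS -IH mulr_suml.
pose A k := rising_factorial a h k.
pose B k := rising_factorial b h (n.+1 - k).
pose F k := 'C(n, k)%:R * (A k.+1 * B k.+1).
pose G k := 'C(n, k)%:R * (A k * B k).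
have -> : \sum_(k < n.+2) 'C(n.+1, k)%:R * (A k * B k) =
          \sum_(k < n.+1) F k + \sum_(k < n.+1) G k.
  have -> : \sum_(k < n.+1) G k = \sum_(k < n.+2) G k.
    by rewrite [RHS]big_ord_recr /= [X in _ = _ + X]/G bin_small // mul0r addr0.
  rewrite [LHS]big_ord_recl [\sum_(k < n.+2) G k]big_ord_recl addrCA -big_split.
  rewrite /G !bin0; congr (_ + _); apply: eq_bigr => k _.
  by rewrite lift0 binS natrD mulrDl addrC.
rewrite -big_split; apply: eq_bigr => k _ /=.
have kn : (k <= n)%N by rewrite -ltnS.
rewrite /F /G /A /B subSS subSn // !rising_factorialS (natrB _ kn); ring.
Qed.

(** * Positivity and likelihood ratios of Pólya mass functions *)

Section PolyaMass.
Variables (R : realType) (a b : R) (n : nat).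
Hypotheses (a_ge0 : 0 <= a) (b_ge0 : 0 <= b) (ab_gt0 : 0 < a + b).

Definition compatible_increment (c : R) :=
  0 <= a + n.-1%:R * c /\ 0 <= b + n.-1%:R * c.

(** The factor is affine in [i], so its sign at the end indices 0 and n - 1 decides. *)
Let factor_ge0 (y c : R) (i : nat) :
  0 <= y -> 0 <= y + n.-1%:R * c -> (i < n)%N -> 0 <= y + i%:R * c.
Proof.
move=> y0 yn lt_in.
have : i%:R <= n.-1%:R :> R by rewrite ler_nat; lia.
have : 0 <= i%:R :> R by [].
by move: (i%:R) (n.-1%:R) yn => s t; have [c0|c0] := leP 0 c; nra.
Qed.

Let rising_factorial_ge0 (y c : R) (m : nat) :
  0 <= y -> 0 <= y + n.-1%:R * c -> (m <= n)%N -> 0 <= rising_factorial y c m.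
Proof.
move=> y0 yn lemn; apply: prodr_ge0 => i _; apply: factor_ge0 => //.
exact: leq_trans (ltn_ord i) lemn.
Qed.

Lemma rising_factorial_neq0_le (y c : R) (k m : nat) : (k <= m)%N ->
  rising_factorial y c m != 0 -> rising_factorial y c k != 0.
Proof.
move=> km /prodf_neq0 h; apply/prodf_neq0 => i _.
exact: (h (widen_ord km i)).
Qed.

Lemma polya_denominator_gt0 (c : R) : compatible_increment c ->
  0 < rising_factorial (a + b) c n.
Proof.
move=> [ac bc]; apply: prodr_gt0 => i _.
have := factor_ge0 a_ge0 ac (ltn_ord i); have := factor_ge0 b_ge0 bc (ltn_ord i).
have [c0|c0] := leP 0 c; first by rewrite ltr_pwDl // mulr_ge0.
(* Twice the factor a + b + s is the sum of a + b > 0 and (a + s) + (b + s) >= 0. *)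
have := ab_gt0; move: (i%:R * c) => s *; lra.
Qed.

Lemma polya_pmf_ge0 (c : R) (k : nat) : compatible_increment c ->
  (k <= n)%N -> 0 <= polya_pmf a b c n k.
Proof.
move=> cc kn; have [ac bc] := cc.
rewrite /polya_pmf mulr_ge0 // divr_ge0 ?(ltW (polya_denominator_gt0 cc)) //.
by rewrite mulr_ge0 // rising_factorial_ge0 // leq_subr.
Qed.

(** At a boundary value of [c] some masses vanish, but the support has no gaps: the rising factorial
    of [a] at k divides the one at j, and that of [b] at n - k divides the one at n - i. *)
Lemma polya_pmf_gt0_between (c : R) (i k j : nat) : compatible_increment c ->
  (i <= k <= j)%N -> (j <= n)%N ->
  0 < polya_pmf a b c n i -> 0 < polya_pmf a b c n j -> 0 < polya_pmf a b c n k.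
Proof.
move=> cc /andP[ik kj] jn pi pj.
rewrite lt_def polya_pmf_ge0 ?(leq_trans kj) // andbT.
move: pi pj => /lt0r_neq0 + /lt0r_neq0; rewrite /polya_pmf !mulf_eq0 !negb_or.
move=> /and3P[_ /andP[_ Bi] D] /and3P[_ /andP[Aj _] _].
apply/and3P; split=> //.
  by rewrite pnatr_eq0 -lt0n bin_gt0 (leq_trans kj).
apply/andP; split; first exact: rising_factorial_neq0_le Aj.
by apply: rising_factorial_neq0_le Bi; apply: leq_sub2l.
Qed.

(** After the common factors are taken out, with m = n - 1 - k, what remains is (a + k c')(b + m c)
    - (b + m c')(a + k c) = (c' - c)(k b - m a). *)
Let cross_difference (c c' : R) (k : nat) : (k < n)%N ->
  polya_pmf a b c' n k.+1 * polya_pmf a b c n k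
    - polya_pmf a b c' n k * polya_pmf a b c n k.+1 =
  'C(n, k.+1)%:R * 'C(n, k)%:R *
    (rising_factorial a c' k * rising_factorial b c' (n - k.+1) *
     (rising_factorial a c k * rising_factorial b c (n - k.+1)) /
     (rising_factorial (a + b) c n * rising_factorial (a + b) c' n)) *
  ((c' - c) * (k%:R * (a + b) - n.-1%:R * a)).
Proof.
move=> kn; rewrite /polya_pmf !rising_factorialS invfM.
have -> : (n - k = (n - k.+1).+1)%N by lia.
rewrite !rising_factorialS.
have -> : (n - k.+1)%:R = n.-1%:R - k%:R :> R.
  by rewrite -natrB; [congr _%:R; lia | lia].
ring.
Qed.

Variables c c' : R.
Hypotheses (cc : compatible_increment c) (cc' : compatible_increment c').
Hypothesis le_cc' : c <= c'.

Let p := polya_pmf a b c n.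
Let q := polya_pmf a b c' n.

Let cross_coefficient_ge0 (k : nat) : (k < n)%N ->
  0 <= 'C(n, k.+1)%:R * 'C(n, k)%:R *
    (rising_factorial a c' k * rising_factorial b c' (n - k.+1) *
     (rising_factorial a c k * rising_factorial b c (n - k.+1)) /
     (rising_factorial (a + b) c n * rising_factorial (a + b) c' n)) :> R.
Proof.
move=> kn; have [ac bc] := cc; have [ac' bc'] := cc'.
rewrite mulr_ge0 // divr_ge0 //; last first.
  by rewrite mulr_ge0 // ltW // polya_denominator_gt0.
by rewrite !mulr_ge0 // rising_factorial_ge0 // ?leq_subr // ltnW.
Qed.

Let ratio_decreasing (k : nat) : (k < n)%N -> k%:R * (a + b) <= n.-1%:R * a ->
  q k.+1 * p k <= q k * p k.+1.
Proof.
move=> kn hk; rewrite -subr_le0 cross_difference //.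
by rewrite mulr_ge0_le0 ?cross_coefficient_ge0 // mulr_ge0_le0 // ?subr_ge0 ?subr_le0.
Qed.

Let ratio_increasing (k : nat) : (k < n)%N -> n.-1%:R * a <= k%:R * (a + b) ->
  q k * p k.+1 <= q k.+1 * p k.
Proof.
move=> kn hk; rewrite -subr_ge0 cross_difference //.
by rewrite mulr_ge0 ?cross_coefficient_ge0 // mulr_ge0 // ?subr_ge0.
Qed.

Lemma polya_pmf_lt_interval (i k j : nat) :
  (i <= k <= j)%N -> (j <= n)%N ->
  polya_pmf a b c' n i < polya_pmf a b c n i ->
  polya_pmf a b c' n j < polya_pmf a b c n j ->
  polya_pmf a b c' n k <= polya_pmf a b c n k.
Proof.
rewrite -/p -/q -/(p i) -/(q i) -/(p j) -/(q j) -/(p k) -/(q k).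
move=> /andP[ik kj] jn qpi qpj.
(* Since q >= 0, the strict inequalities make p positive at both ends, hence in between; this allows
   cancelling p below. *)
have p_gt0 m : (i <= m <= j)%N -> 0 < p m.
  move=> imj; apply: (@polya_pmf_gt0_between c i m j) => //.
    by apply: le_lt_trans qpi; apply: polya_pmf_ge0 => //; lia.
  by apply: le_lt_trans qpj; apply: polya_pmf_ge0.
(* If k is before the turning point of q / p, the ratio decreases from i to k, so q <= p propagates
   upwards from i; otherwise it propagates downwards from j. *)
have [hk|/ltW hk] := leP (k%:R * (a + b)) (n.-1%:R * a).
  have up m : (i + m <= k)%N -> q (i + m)%N <= p (i + m)%N.
    elim: m => [|m IH] imk; first by rewrite addn0 ltW.
    rewrite addnS in imk *.
    have pm : 0 < p (i + m)%N by apply: p_gt0; lia.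
    have pm1 : 0 < p (i + m).+1 by apply: p_gt0; lia.
    rewrite -(ler_pM2r pm) mulrC.
    rewrite (mulrC (p _.+1)) -(mulrC (q _)).
    apply: (le_trans (ratio_decreasing _ _)); first lia.
      by apply: le_trans hk; rewrite ler_wpM2r ?ler_nat ?(ltW ab_gt0) //; lia.
    by rewrite ler_wpM2r ?(ltW pm1) // IH // ltnW.
  by have := up (k - i)%N; rewrite subnKC //; apply.
have down m : (m <= j - k)%N -> q (j - m)%N <= p (j - m)%N.
  elim: m => [|m IH] mjk; first by rewrite subn0 ltW.
  have jm : (j - m = (j - m.+1).+1)%N by lia.
  have {IH} := IH (ltnW mjk); rewrite jm.
  set l := (j - m.+1)%N => IH.
  have pl : 0 < p l by apply: p_gt0; rewrite /l; lia.
  have pl1 : 0 < p l.+1 by apply: p_gt0; rewrite /l; lia.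
  rewrite -(ler_pM2r pl1).
  apply: (le_trans (ratio_increasing _ _)); first by rewrite /l; lia.
    apply: le_trans hk _; rewrite ler_wpM2r ?ler_nat ?(ltW ab_gt0) //.
    by rewrite /l; lia.
  by rewrite mulrC ler_wpM2l // ltW.
by have := down (j - k)%N; rewrite subKn //; apply.
Qed.

End PolyaMass.

(** * Total mass and mean *)

Lemma sum_polya_pmf (R : realType) (a b c : R) n :
  rising_factorial (a + b) c n != 0 ->
  \sum_(k < n.+1) polya_pmf a b c n k = 1.
Proof.
move=> D; under eq_bigr => k _ do rewrite /polya_pmf mulrA.
by rewrite -mulr_suml chu_vandermonde divff.
Qed.

(** Absorbing k into the binomial coefficient and pulling out the first factors [a] and [a + b]
    leaves the mass function with parameters [a + c], [b] and n - 1, whose total mass is 1. *)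
Lemma mean_polya_pmf (R : realType) (a b c : R) n :
  rising_factorial (a + b) c n != 0 ->
  \sum_(k < n.+1) polya_pmf a b c n k * k%:R = n%:R * a / (a + b).
Proof.
case: n => [|n] D; first by rewrite big_ord1 mulr0 !mul0r.
rewrite big_ord_recl mulr0 add0r.
move: D; rewrite rising_factorialSl mulf_eq0 negb_or => /andP[ab D].
transitivity (\sum_(k < n.+1) n.+1%:R * a / (a + b) * polya_pmf (a + c) b c n k).
  apply: eq_bigr => k _; rewrite lift0 /polya_pmf subSS !rising_factorialSl.
  have : (k.+1 * 'C(n.+1, k.+1))%:R = (n.+1 * 'C(n, k))%:R :> R.
    by rewrite -mul_bin_diag.
  rewrite !natrM => e; rewrite [LHS]mulrC [LHS]mulrA e (addrAC a) invfM; ring.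
by rewrite -mulr_sumr sum_polya_pmf ?mulr1 // addrAC.
Qed.

(** * Convex functions summed against signed weights *)

Lemma convex_chord_nat (R : realType) (phi : R -> R) (u v w : nat) :
  @convex_function R R^o setT phi -> (u < v)%N -> (v < w)%N ->
  (w%:R - u%:R) * phi v%:R <=
  (w%:R - v%:R) * phi u%:R + (v%:R - u%:R) * phi w%:R.
Proof.
move=> cphi uv vw.
have luv : u%:R < v%:R :> R by rewrite ltr_nat.
have lvw : v%:R < w%:R :> R by rewrite ltr_nat.
have uw0 : 0 < w%:R - u%:R :> R by lra.
pose t : R := (w%:R - v%:R) / (w%:R - u%:R).
have t0 : 0 <= t by rewrite divr_ge0 //; lra.
have t1 : t <= 1 by rewrite ler_pdivrMr //; lra.
have tE : t * u%:R + (1 - t) * w%:R = v%:R by rewrite /t; field; rewrite gt_eqF.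
have : phi (t * u%:R + (1 - t) * w%:R) <= t * phi u%:R + (1 - t) * phi w%:R.
  by apply: (cphi (Itv01 t0 t1)); rewrite inE.
rewrite tE -(ler_pM2l uw0) => /le_trans; apply.
rewrite le_eqVlt; apply/orP; left; apply/eqP.
by rewrite /t; field; rewrite gt_eqF.
Qed.

Lemma convex_sum_ge0 (R : realType) (phi : R -> R) (n : nat) (d : nat -> R) :
  @convex_function R R^o setT phi ->
  \sum_(k < n.+1) d k = 0 -> \sum_(k < n.+1) d k * k%:R = 0 ->
  (forall i k j, (i <= k <= j)%N -> (j <= n)%N -> d i < 0 -> d j < 0 -> d k <= 0) ->
  0 <= \sum_(k < n.+1) d k * phi k%:R.
Proof.
move=> cphi d0 d1 interval.
pose N k := (k <= n)%N && (d k < 0).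
have [exN|noN] := pselect (exists k, N k); last first.
  (* Nonnegative weights with sum zero all vanish. *)
  have dge0 (k : 'I_n.+1) : true -> 0 <= d k.
    move=> _; rewrite leNgt; apply/negP => dk; apply: noN; exists k.
    by rewrite /N dk andbT -ltnS.
  rewrite big1 // => k _.
  move/eqP: d0; rewrite psumr_eq0 // => /allP/(_ k (mem_index_enum _))/eqP ->.
  by rewrite mul0r.
have [i /andP[ile di] imin] := ex_minnP exN.
have Nle k : N k -> (k <= n)%N by case/andP.
have [j /andP[jle dj] jmax] := ex_maxnP exN Nle.
have ij : (i < j.+1)%N by rewrite ltnS; apply: imin; rewrite /N jle.
(* The chord runs through [j.+1] rather than [j] so that it is defined when [i = j]. *)
pose g k := (j.+1%:R - i%:R) * phi k%:R -
  ((j.+1%:R - k%:R) * phi i%:R + (k%:R - i%:R) * phi j.+1%:R) : R.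
have ji : 0 < j.+1%:R - i%:R :> R by rewrite subr_gt0 ltr_nat.
rewrite -(pmulr_rge0 _ ji) mulr_sumr.
have -> : \sum_(k < n.+1) (j.+1%:R - i%:R) * (d k * phi k%:R) =
          \sum_(k < n.+1) d k * g k.
  (* The two sums differ by an affine function of k summed against [d], which is zero by the two
     moment conditions. *)
  apply/eqP; rewrite -subr_eq0 -sumrB.
  have e (k : 'I_n.+1) : true -> (j.+1%:R - i%:R) * (d k * phi k%:R) - d k * g k =
     (j.+1%:R * phi i%:R - i%:R * phi j.+1%:R) * d k +
     (phi j.+1%:R - phi i%:R) * (d k * k%:R) by rewrite /g => _; ring.
  by rewrite (eq_bigr _ e) big_split /= -!mulr_sumr d0 d1 !mulr0 addr0.
apply: sumr_ge0 => k _.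
have kn : (k <= n)%N by rewrite -ltnS.
(* Outside [i, j + 1], extremality of i and j gives [d k] >= 0 and phi lies above the extended
   chord; strictly inside, both signs are reversed; at the ends [g] is zero. *)
have [ki|ik|ki] := ltngtP k i.
- apply: mulr_ge0.
    rewrite leNgt; apply/negP => dk.
    by have := imin k; rewrite /N kn dk => /(_ isT); rewrite leqNgt ki.
  have := convex_chord_nat cphi ki ij; rewrite /g.
  lra.
- have [jk|kj|kj] := ltngtP k j.+1.
  + apply: mulr_le0; first by apply: (interval i k j) => //; lia.
    have := convex_chord_nat cphi ik jk; rewrite /g.
    lra.
  + apply: mulr_ge0.
      rewrite leNgt; apply/negP => dk.
      by have := jmax k; rewrite /N kn dk => /(_ isT); lia.
    have := convex_chord_nat cphi ij kj; rewrite /g.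
    lra.
  + by rewrite /g kj subrr mul0r add0r subrr mulr0.
- by rewrite /g ki subrr mul0r addr0 subrr mulr0.
Qed.

(** The space is the disjoint union of the n + 1 fibres of [X], and [phi \o X] is constant on
    each. *)
Lemma expectation_nat_valued (R : realType) (d : measure_display)
    (T : measurableType d) (P : probability T R) (X : {RV P >-> R}) (n : nat)
    (p : nat -> R) (phi : R -> R) :
  (forall w, exists2 k : nat, (k <= n)%N & X w = k%:R) ->
  (forall k : nat, (k <= n)%N -> P (X @^-1` [set k%:R])%classic = (p k)%:E) ->
  measurable_fun setT (phi \o X) ->
  'E_P[phi \o X]%E = (\sum_(k < n.+1) p k * phi k%:R)%:E.
Proof.
move=> Xn Xp mphi; rewrite unlock.
pose F (k : 'I_n.+1) := (X @^-1` [set k%:R])%classic.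
have mF k : measurable (F k) by rewrite -[F k]setTI; apply: measurable_funPT.
have -> : setT = (\big[setU/set0]_(k <- enum 'I_n.+1) F k)%classic.
  apply/esym/seteqP; split=> // w _; rewrite big_enum /=.
  have [k kn Xw] := Xn w.
  by rewrite (bigD1 (Ordinal (kn : (k < n.+1)%N))) //=; left.
rewrite integral_bigsetU_EFin ?enum_uniq //.
- rewrite big_enum /= -sumEFin; apply: eq_bigr => k _.
  rewrite (@eq_integral _ _ _ _ _ (cst (phi k%:R)%:E)); last first.
    by move=> w; rewrite inE /F /= => ->.
  rewrite integral_cst // mulrC EFinM; congr (_ * _)%E.
  by apply: Xp; rewrite -ltnS.
- move=> i j _ _ [w [/= Xi Xj]]; apply/val_inj/eqP.
  by rewrite -(eqr_nat R) -Xi Xj.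
- exact/measurable_funTS/measurable_EFinP.
Qed.

Unset Implicit Arguments.
Set Strict Implicit.
Set Printing Implicit Defensive.

Theorem theorem3p3 (R : realType) (n : nat) (x c c' : R)
  (hn : (1 <= n)%N)
  (hx : 0 <= x <= 1)
  (hc : (2 <= n)%N -> - (1 / (n - 1)%:R) * Num.min x (1 - x) <= c)
  (hcc' : c <= c')
  (d1 : measure_display) (T1 : measurableType d1) (P : probability T1 R)
  (X : {RV P >-> R})
  (d2 : measure_display) (T2 : measurableType d2) (Q : probability T2 R)
  (Y : {RV Q >-> R})
  (hX : polya_rv X x (1 - x) c n)
  (hY : polya_rv Y x (1 - x) c' n) :
  convex_order X Y.
Proof.
move=> phi cphi [mX _] [mY _].
case: hX hY => [Xn Xp] [Yn Yp].
rewrite (expectation_nat_valued Xn Xp mX).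
rewrite (expectation_nat_valued Yn Yp mY).
have /andP[x0 x1] := hx.
have y0 : 0 <= 1 - x by rewrite subr_ge0.
have xy : 0 < x + (1 - x) by rewrite subrKC.
(* The lower bound on [c] passes to every larger increment, so this serves both [c] and [c']. For n
   = 1 the condition only says that x and 1 - x are nonnegative. *)
have compat e : c <= e -> compatible_increment x (1 - x) n e.
  move=> ce; rewrite /compatible_increment.
  have [n2|n2] := leqP 2 n; last first.
    have -> : n.-1%:R = 0 :> R by rewrite (_ : n.-1 = 0%N) //; lia.
    by rewrite !mul0r !addr0.
  have := le_trans (hc n2) ce; rewrite subn1.
  have n0 : 0 < n.-1%:R :> R by rewrite ltr0n; lia.
  rewrite mulNr div1r mulrC lerNl ler_pdivlMr // le_min.
  by move=> /andP[h1 h2]; split; lra.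
have cc := compat _ (lexx c); have cc' := compat _ hcc'.
have D := lt0r_neq0 (polya_denominator_gt0 x0 y0 xy cc).
have D' := lt0r_neq0 (polya_denominator_gt0 x0 y0 xy cc').
rewrite lee_fin -subr_ge0 -sumrB.
under eq_bigr => k _ do rewrite -mulrBl.
apply: (@convex_sum_ge0 _ _ _
  (fun k => polya_pmf x (1 - x) c' n k - polya_pmf x (1 - x) c n k)) => //.
- by rewrite sumrB !sum_polya_pmf // subrr.
- under eq_bigr => k _ do rewrite mulrBl.
  by rewrite sumrB !mean_polya_pmf // subrr.
- move=> i k j ikj jn; rewrite !subr_lt0 subr_le0.
  by apply: polya_pmf_lt_interval.
Qed.
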